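(* Let $M$ be an irreducible highest weight $\widehat{\mathcal C}$-module with highest weight $\xi\in(\widehat{\mathcal C}_0)^*$, and let $v_\xi$ be a non-zero highest weight vector. Then the following are equivalent: (i) $M$ is quasi-finite; (ii) $\widehat{\mathcal C}_{-\frac12}v_\xi$ is finite dimensional; (iii) there exists $N\in\mathbb N$ such that $\xi=\sum_{j\in\frac12\mathbb N,\ j\le N}\xi_j\omega_j+d\Lambda_0$ for some $\xi_j,d\in\mathbb C$.
   Context: All vector spaces are over $\mathbb C$; $\mathbb N=\{1,2,\dots\}$, $\mathbb Z_+=\{0,1,2,\dots\}$, $\mathbb Z^*=\mathbb Z\setminus\{0\}$. Let $\mathrm{gl}_{\infty|\infty}$ be the space of complex matrices $(a_{ij})_{i,j\in\frac12\mathbb Z}$ with $a_{ij}=0$ for $|i-j|\gg0$; $e_{pq}$ denotes the matrix unit. It is $\frac12\mathbb Z$-graded: the degree-$k$ component consists of all $\sum_{j\in\frac12\mathbb Z}a_je_{j-k,j}$. Elements of integer degree are even, elements of degree in $\frac12+\mathbb Z$ are odd, and $[A,B]=AB-(-1)^{|A||B|}BA$. Let $J=\sum_{r\le0}e_{rr}$, $\mathrm{Str}(D)=\sum_{r}(-1)^{2r}d_{rr}$, $\alpha(A,B)=\mathrm{Str}([J,A]B)$. Then $\widehat{\mathrm{gl}}_{\infty|\infty}=\mathrm{gl}_{\infty|\infty}\oplus\mathbb CC$ is the central extension with $C$ even, central, of degree $0$, and the bracket of $A,B\in\mathrm{gl}_{\infty|\infty}$ equal to $[A,B]+\alpha(A,B)C$.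 Let $\mathcal A\subset \mathrm{gl}_{\infty|\infty}$ be the matrices with $a_{ij}=0$ if $i=0$ or $j=0$; it acts on the superspace $V$ with even basis $e_j$ ($j\in\mathbb Z^*$) and odd basis $e_r$ ($r\in\frac12+\mathbb Z$). Let $(\cdot|\cdot)$ be the bilinear form on $V$ with $(e_i|e_j)=\mathrm{sgn}(i)\delta_{i,-j}$ ($i,j\in\mathbb Z^*$), $(e_r|e_s)=\delta_{r,-s}$ ($r,s\in\frac12+\mathbb Z$), $(e_i|e_r)=(e_r|e_i)=0$. Let $\mathcal C\subset\mathcal A$ be the graded subalgebra spanned by the $A\in \mathcal A$ of parity $\epsilon\in\{0,1\}$ satisfying $(Av|w)=-(-1)^{\epsilon|v|}(v|Aw)$ for all homogeneous $v$ and all $w$ in $V$, and let $\widehat{\mathcal C}=\mathcal C\oplus\mathbb CC\subset\widehat{\mathrm{gl}}_{\infty|\infty}$ with the induced grading. Put $\tilde e_{rr}=e_{rr}-e_{-r,-r}$ for $r\in\frac12\mathbb N$; then $\widehat{\mathcal C}_0=\{\sum_{r\in\frac12\mathbb N}a_r\tilde e_{rr}+dC\}$. Define $\omega_s$ ($s\in\frac12\mathbb N$), $\Lambda_0\in(\widehat{\mathcal C}_0)^*$ by $\omega_s(\sum a_r\tilde e_{rr}+dC)=a_s$, $\Lambda_0(\sum a_r\tilde e_{rr}+dC)=d$. For a $\frac12\mathbb Z$-graded Lie superalgebra $\mathfrak g$ with $\mathfrak g_0$ abelian, put $\mathfrak g_\pm=\bigoplus_{r>0}\mathfrak g_{\pm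 r}$. A highest weight module with highest weight $\xi\in\mathfrak g_0^*$ is a module $M$ containing a non-zero vector $v_\xi$ (highest weight vector) with $hv_\xi=\xi(h)v_\xi$ for $h\in\mathfrak g_0$, $\mathfrak g_+v_\xi=0$, $\mathcal U(\mathfrak g_-)v_\xi=M$. It is graded, $M=\bigoplus_{j\in\frac12\mathbb Z_+}M_{-j}$, by giving $v_\xi$ degree $0$. $M$ is quasi-finite if $\dim M_j<\infty$ for all $j$. *)

(* Defs.v *)
From mathcomp Require Import all_boot all_order all_algebra.
From mathcomp Require Import complex.
From mathcomp Require Import all_classical all_reals.

Set Implicit Arguments.
Unset Strict Implicit.
Unset Printing Implicit Defensive.

Import Order.TTheory GRing.Theory Num.Theory.
Local Open Scope classical_set_scope.
Local Open Scope ring_scope.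

(* Half-integers are doubled throughout: the index r in (1/2)Z is encoded by   *)
(* the integer 2r, a degree k in (1/2)Z by 2k.  Thus even integers encode      *)
(* integral indices and odd integers those in 1/2 + Z.                         *)
(* Parities are booleans, true being odd.                                      *)

Section LinearSpan.
Context {K : fieldType} {E : lmodType K}.

Definition subspace (S : set E) : Prop :=
  S 0 /\ forall (a : K) (x y : E), S x -> S y -> S (a *: x + y).

Definition lspan (S : set E) : set E :=
  [set x | exists (n : nat) (c : 'I_n -> K) (s : 'I_n -> E),
     (forall i, S (s i)) /\ x = \sum_i c i *: s i].

Definition fin_dim (S : set E) : Prop :=
  exists s : seq E, S `<=` lspan [set` s].

End LinearSpan.

(* A member of gl(oo|oo) is a function with the predicate [banded] below.  The *)
(* finitely-supported sum \sum_(k \in setT) is 0 on infinite supports; in all  *)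
(* the sums below the supports are finite as soon as the matrices involved are *)
(* banded.                                                                     *)
Notation mat K := (int -> int -> K^o).
Notation hmat K := ((int -> int -> K^o) * K^o)%type.

Section GeneralLinear.
Context {K : fieldType}.
Implicit Types (A B : mat K) (e : bool) (k : int).

Definition banded A : Prop :=
  exists n : nat, forall i j : int, (n < `|i - j|)%N -> A i j = 0.

Definition mat_degree k A : Prop :=
  forall i j : int, i != j - k -> A i j = 0.

Definition mat_parity e A : Prop :=
  forall i j : int, odd `|i - j|%N != e -> A i j = 0.

Definition parity_part e A : mat K :=
  fun i j => if odd `|i - j|%N == e then A i j else 0.

Definition mat_mul A B : mat K :=
  fun i j => \sum_(k \in [set: int]) A i k * B k j.

(* The bilinear extension of AB - (-1)^{|A||B|} BA to inhomogeneous A and B.   *)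
Definition sbracket A B : mat K :=
  mat_mul A B
  - \sum_(e : bool) \sum_(f : bool)
      (-1) ^+ (e && f) *: mat_mul (parity_part f B) (parity_part e A).

Definition Jmat : mat K := fun i j => ((i == j) && (i <= 0))%:R.

(* (-1)^{2r} for the index r of (1/2)Z encoded by i = 2r. *)
Definition Str A : K := \sum_(i \in [set: int]) (-1) ^+ odd `|i|%N * A i i.

Definition alpha A B : K := Str (mat_mul (sbracket Jmat A) B).

(* The pair (A, c) is A + c C in the central extension of gl(oo|oo). *)
Definition hbracket (x y : hmat K) : hmat K :=
  (sbracket x.1 y.1, alpha x.1 y.1).

Definition hmat_degree k (x : hmat K) : Prop :=
  mat_degree k x.1 /\ (k != 0 -> x.2 = 0).

Definition hmat_parity e (x : hmat K) : Prop :=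
  mat_parity e x.1 /\ (e -> x.2 = 0).

Definition in_A : set (mat K) :=
  [set A | banded A /\ forall i j : int, (i == 0) || (j == 0) -> A i j = 0].

(* The superspace V: v stands for the sum of the v i e_i, i <> 0. *)
Definition in_V : set (int -> K) :=
  [set v | finite_set [set i | v i != 0] /\ v 0 = 0].

Definition vec_parity e (v : int -> K) : Prop :=
  forall i : int, odd `|i|%N != e -> v i = 0.

Definition mat_act A (v : int -> K) : int -> K :=
  fun i => \sum_(j \in [set: int]) A i j * v j.

Definition form_basis (i j : int) : K :=
  if i == - j then (if odd `|i|%N then 1 else (Num.sg i)%:~R) else 0.

Definition form (v w : int -> K) : K :=
  \sum_(i \in [set: int]) \sum_(j \in [set: int]) v i * w j * form_basis i j.

Definition skew_form e A : Prop :=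
  forall (f : bool) (v w : int -> K), in_V v -> vec_parity f v -> in_V w ->
    form (mat_act A v) w = - (-1) ^+ (e && f) * form v (mat_act A w).

Definition in_C : set (mat K) :=
  lspan [set A | in_A A /\ exists e, mat_parity e A /\ skew_form e A].

Definition in_Chat : set (hmat K) := [set x | in_C x.1].

Definition Chat_ k : set (hmat K) := [set x | in_Chat x /\ hmat_degree k x].

Definition Chat_minus : set (hmat K) :=
  lspan [set x | exists2 k : int, 0 < k & Chat_ (- k) x].

(* The sum over r in (1/2)N of a_r (e_{rr} - e_{-r,-r}), plus d C, where a_r   *)
(* is [a (2r)].                                                                *)
Definition Chat0_elt (a : nat -> K) (d : K) : hmat K :=
  (fun i j : int => if i == j then (Num.sg i)%:~R * a `|i|%N else 0, d).

(* omega_{s/2}, for s > 0: see [Chat0P] and [omegaE]. *)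
Definition omega (s : nat) (x : hmat K) : K := x.1 s%:Z s%:Z.
Definition Lambda0 (x : hmat K) : K := x.2.

Lemma omegaE (s : nat) (a : nat -> K) (d : K) :
  (0 < s)%N -> omega s (Chat0_elt a d) = a s.
Proof. by case: s => // s _; rewrite /omega /= eqxx mul1r. Qed.

Lemma fsum_single (i : int) (F : int -> K) :
  (forall j, j != i -> F j = 0) -> \sum_(j \in [set: int]) F j = F i.
Proof.
move=> F0; rewrite -(fsbig_widen [set i] setT) ?fsbig_set1//.
by move=> j [_ /= /eqP/F0].
Qed.

Lemma formE (v w : int -> K) :
  form v w = \sum_(i \in [set: int]) v i * w (- i) * form_basis i (- i).
Proof.
apply: eq_fsbigr => i _; apply: fsum_single => j ji.
rewrite /form_basis ifN ?mulr0//.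
by rewrite -eqr_oppLR eq_sym.
Qed.

Definition unit_vec (i : int) : int -> K := fun j => (j == i)%:R.

Lemma in_V_delta i : i != 0 -> in_V (unit_vec i).
Proof.
move=> i0; split; last by rewrite /unit_vec eq_sym (negbTE i0).
apply: (@sub_finite_set _ _ [set i]) => // j /=.
by rewrite /unit_vec; case: (j =P i) => // _ /eqP.
Qed.

Lemma mat_act_delta A i : mat_act A (unit_vec i) = fun k => A k i.
Proof.
apply/funext => k; rewrite /mat_act (fsum_single (i := i)) /unit_vec ?eqxx ?mulr1//.
by move=> j /negbTE->; rewrite mulr0.
Qed.

Lemma sgz_opp_cast i : (Num.sg (- i))%:~R = - (Num.sg i)%:~R :> K.
Proof. by rewrite sgrN rmorphN. Qed.

Lemma form_basis_neq0 i : i != 0 -> form_basis i (- i) != 0.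
Proof.
move=> i0; rewrite /form_basis opprK eqxx; case: ifP => _; rewrite ?oner_eq0//.
by case: sgrP i0 => // _ _; rewrite ?rmorphN ?oppr_eq0 oner_eq0.
Qed.

Lemma skew_form_diag A i : i != 0 -> skew_form false A ->
  A i i = - A (- i) (- i).
Proof.
move=> i0 /(_ (odd `|i|%N) (unit_vec i) (unit_vec (- i)) (in_V_delta i0)).
rewrite !formE (fsum_single (i := i)); last first.
  by move=> j ji; rewrite {2}/unit_vec eqr_opp (negbTE ji) mulr0 mul0r.
rewrite (fsum_single (i := i)); last first.
  by move=> j ji; rewrite {1}/unit_vec (negbTE ji) !mul0r.
rewrite !mat_act_delta /unit_vec !eqxx mulr1 mul1r expr0 mulN1r -mulNr.
move=> H; apply: (mulIf (form_basis_neq0 i0)); apply: H.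
  by move=> j oj; rewrite (_ : j == i = false)//; apply: contraNF oj => /eqP->.
by apply: in_V_delta; rewrite oppr_eq0.
Qed.

Lemma in_C_diag A i : in_C A -> A i i = - A (- i) (- i).
Proof.
move=> [n [c [s [sP ->]]]].
have E (j : int) : (\sum_i0 c i0 *: s i0) j j = \sum_i0 c i0 * s i0 j j.
  by elim/big_rec2: _ => // k x y _ <-.
rewrite !E -sumrN; apply: eq_bigr => k _; rewrite -mulrN; congr (_ * _).
have [[_ s0] [e [pe se]]] := sP k.
have [->|i0] := eqVneq i 0; first by rewrite oppr0 s0 ?eqxx// oppr0.
case: e pe se => [pe _|_]; last exact: skew_form_diag.
by rewrite !pe ?oppr0// subrr.
Qed.

Lemma Chat0P : Chat_ 0 = [set x | exists a d, x = Chat0_elt a d].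
Proof.
apply/seteqP; split => [[A d] [/= AC [/= dA _]]|_ [a [d ->]]].
  exists (fun n => A n%:Z n%:Z), d; congr pair.
  apply/funext => i; apply/funext => j.
  case: eqVneq => [<-|ij]; last by rewrite dA// subr0.
  have A0 : A 0 0 = 0.
    case: (AC) => n [c [s [sP /= ->]]].
    have E : (\sum_i0 c i0 *: s i0) 0 0 = \sum_i0 c i0 * s i0 0 0.
      by elim/big_rec2: _ => // k x y _ <-.
    rewrite E big1// => k _; have [[_ s0] _] := sP k.
    by rewrite s0 ?mulr0.
  case: (sgrP i) => [->|i0|i0]; first by rewrite mul0r.
    by rewrite mul1r gez0_abs// ltW.
  by rewrite rmorphN mulN1r lez0_abs 1?ltW// -in_C_diag.
split; last by split => //= i j; rewrite subr0 => /negbTE->.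
exists 1%N, (fun=> 1), (fun=> (Chat0_elt a d).1); split; last first.
  by rewrite big_ord1 scale1r.
move=> _; split.
  split; first exists 0%N.
    by move=> i j; rewrite /=; case: (i =P j) => // ->; rewrite subrr.
  move=> i j; rewrite /=; case: (i =P j) => // <-; rewrite orbb => /eqP->.
  by rewrite sgr0 mul0r.
exists false; split.
  by move=> i j /=; case: (i =P j) => // ->; rewrite subrr.
move=> f v w vV _ wV; rewrite !formE expr0 mulN1r.
have actE u i : mat_act (Chat0_elt a d).1 u i
    = (Num.sg i)%:~R * a `|i|%N * u i.
  rewrite /mat_act (fsum_single (i := i)) ?eqxx//= ?eqxx//.
  by move=> j ji; rewrite eq_sym (negbTE ji) mul0r.
rewrite (eq_fsbigr (fun i => - (v i * mat_act (Chat0_elt a d).1 w (- i)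
  * form_basis i (- i)))); last first.
  move=> i _; rewrite !actE sgz_opp_cast abszN !mulNr mulrN mulNr opprK.
  by congr (_ * _); rewrite mulrA (mulrC (v i)).
have -> : forall F : int -> K, 
  \sum_(i \in [set: int]) - F i = - \sum_(i \in [set: int]) F i.
  move=> F; rewrite -sumrN; congr bigop.body.
  have E : [set: int] `&` (fun i => - F i) @^-1` [set~ 0]
      = [set: int] `&` F @^-1` [set~ 0].
    apply/seteqP; split=> i /= [_ /eqP Fi]; split => //; apply/eqP.
      by rewrite -oppr_eq0.
    by rewrite oppr_eq0.
  by rewrite /finite_support !unlock E.
by [].
Qed.

Definition linear_on_Chat0 (xi : hmat K -> K) : Prop :=
  forall (c : K) (x y : hmat K), Chat_ 0 x -> Chat_ 0 y ->
    xi (c *: x + y) = c * xi x + xi y.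

End GeneralLinear.

Section Modules.
Context {K : fieldType} {M : lmodType K}.
(* The even and odd parts of M, and the action, whose values outside of Chat   *)
(* are irrelevant.                                                             *)
Variables (Mp : bool -> set M) (act : hmat K -> M -> M).

Definition superspace : Prop :=
  [/\ forall e, subspace (Mp e),
      forall v, exists v0 v1, [/\ Mp false v0, Mp true v1 & v = v0 + v1]
    & forall v, Mp false v -> Mp true v -> v = 0].

Definition Chat_module : Prop :=
  [/\ superspace,
      forall (x : hmat K) (a : K) (v w : M), in_Chat x ->
        act x (a *: v + w) = a *: act x v + act x w,
      forall (a : K) (x y : hmat K) (v : M), in_Chat x -> in_Chat y ->
        act (a *: x + y) v = a *: act x v + act y v,
      forall (e f : bool) (x : hmat K) (v : M),
        in_Chat x -> hmat_parity e x -> Mp f v -> Mp (e (+) f) (act x v)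
    & forall (e f : bool) (x y : hmat K) (v : M),
        in_Chat x -> hmat_parity e x -> in_Chat y -> hmat_parity f y ->
        act (hbracket x y) v
          = act x (act y v) - (-1) ^+ (e && f) *: act y (act x v)].

Definition submodule (W : set M) : Prop :=
  [/\ subspace W,
      forall v0 v1, Mp false v0 -> Mp true v1 -> W (v0 + v1) -> W v0 /\ W v1
    & forall x v, in_Chat x -> W v -> W (act x v)].

Definition irreducible : Prop :=
  (exists v : M, v != 0) /\
  forall W : set M, submodule W -> W = [set 0] \/ W = [set: M].

(* The product x_1 ... x_n in U(Chat) applied to v. *)
Definition act_word (xs : seq (hmat K)) (v : M) : M := foldr act v xs.

Definition Uminus_orbit (v : M) : set M :=
  lspan [set u | exists xs : seq (hmat K),
           (forall x, x \in xs -> Chat_minus x) /\ u = act_word xs v].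

Definition highest_weight_vector (xi : hmat K -> K) (v : M) : Prop :=
  [/\ v != 0,
      forall h, Chat_ 0 h -> act h v = xi h *: v,
      forall (k : int) (x : hmat K), 0 < k -> Chat_ k x -> act x v = 0
    & Uminus_orbit v = [set: M]].

(* The component M_{-j} (of degree -j/2 undoubled) of the grading with v in    *)
(* degree 0: the span of the x_1 ... x_n v with x_i of degree - ks_i < 0 and   *)
(* the ks_i summing up to j.                                                   *)
Definition hw_component (v : M) (j : nat) : set M :=
  lspan [set u | exists (n : nat) (ks : 'I_n -> nat) (xs : 'I_n -> hmat K),
           [/\ forall i, (0 < ks i)%N /\ Chat_ (- (ks i)%:Z) (xs i),
               (\sum_i ks i = j)%N
             & u = act_word [seq xs i | i <- enum 'I_n] v]].

Definition quasi_finite (v : M) : Prop := forall j, fin_dim (hw_component v j).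

End Modules.

(* Main.v *)
Require Import Defs.
From mathcomp Require Import all_boot all_order all_algebra.
From mathcomp Require Import complex.
From mathcomp Require Import all_classical all_reals.
From mathcomp Require Import zify ring.
Import Order.TTheory GRing.Theory Num.Theory.
Local Open Scope classical_set_scope.
Local Open Scope ring_scope.

Set Implicit Arguments.
Unset Strict Implicit.
Unset Printing Implicit Defensive.

(* All degrees are doubled, as in the definitions.                             *)
(*                                                                             *)
(* (ii) => (iii): let F(p) be the degree -1 element of the algebra with the    *)
(* entries p(i).  If the F(t^m) v span a finite dimensional space, then        *)
(* F(P) v = 0 for some nonzero polynomial P, so xi kills all the brackets      *)
(* [E(b), F(P)] with E(b) of degree 1.  As P has finitely many natural roots,  *)
(* these brackets contain all the diagonal elements supported far from the     *)
(* origin.  (A relation of finite support would not suffice, since xi is an    *)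
(* arbitrary functional on an infinite product.)                               *)
(*                                                                             *)
(* (iii) => (i): the elements of negative degree with entries only at indices  *)
(* beyond N kill v: the submodule generated by their images lies in the sum of *)
(* the eigenspaces, other than that of v, of the grading element (the sum of   *)
(* all the i e_ii, which belongs to the degree 0 part), so it is proper.       *)
(* Commuting, the elements with entries beyond N + d kill the vectors of       *)
(* degree -d, and in each degree these elements form a subspace of finite      *)
(* codimension.                                                                *)

(** A homogeneous element is a sequence: degree [k] consists of the matrices with entries a i at (i,
    i + k), a being [twisted], together with the central line when k = 0 ([Chat_shiftP]). All
    brackets are computed on such sequences.

    (i) => (ii) is an inclusion, since one-letter words of degree -1 lie in the first component.

    (ii) => (iii): [lspan_dependent] supplies the polynomial P. By [raise_lower] the bracket of E(b)
    with F(P) is the diagonal with entries b n P(n + 1) + P(n) b (n - 1), where b 0 = 0. Beyond the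
    roots of P this recursion can be solved for b with any prescribed diagonal ([fin_dim_weight]),
    so xi sees only finitely many coordinates and C ([linear_weight_expansion]).

    (iii) => (i): xi vanishes on the [far] diagonals without central part. This makes [far_span] a
    submodule, and [far_span_vacuum] shows that it misses v, whence [far_annihilates]. Moving a far
    element past the letters of a word extends this to all descendants of v
    ([far_annihilates_desc]). As far elements have finite codimension in each degree
    ([Chat_far_finite]), an induction on the depth gives finite spanning sets ([desc_fin_dim]). *)

Lemma odd_abszD (i j : int) : odd `|(i + j)%R|%N = odd `|i|%N (+) odd `|j|%N.
Proof. lia. Qed.

(** * Homogeneous matrices *)

Section Shift.
Context {K : fieldType}.
Implicit Types (k l i j : int) (a b : int -> K).

Definition shift_mat k a : mat K := fun i j => if j == i + k then a i else 0.

Lemma shift_mat_degree k a : mat_degree k (shift_mat k a).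
Proof.
move=> i j; rewrite /shift_mat => ijk; rewrite ifN//.
by apply: contraNneq ijk => ->; rewrite addrK.
Qed.

Lemma mat_degree_shift k (A : mat K) :
  mat_degree k A -> A = shift_mat k (fun i => A i (i + k)).
Proof.
move=> Ak; apply/funext => i; apply/funext => j; rewrite /shift_mat.
case: eqVneq => [->//|jik]; apply: Ak.
by apply: contraNneq jik => ->; rewrite subrK.
Qed.

Lemma shift_matP (c : K) k a b :
  c *: shift_mat k a + shift_mat k b = shift_mat k (fun i => c * a i + b i).
Proof.
apply/funext => i; apply/funext => j.
transitivity (c * shift_mat k a i j + shift_mat k b i j : K) => //.
by rewrite /shift_mat; case: ifP => // _; rewrite mulr0 addr0.
Qed.

Lemma shift_matB k a b :
  shift_mat k a - shift_mat k b = shift_mat k (fun i => a i - b i).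
Proof.
rewrite addrC -scaleN1r shift_matP; congr shift_mat.
by apply/funext => i; rewrite mulN1r addrC.
Qed.

Lemma shift_matZ (c : K) k a :
  c *: shift_mat k a = shift_mat k (fun i => c * a i).
Proof.
have := shift_matP c k a (fun=> 0).
have -> : shift_mat k (fun=> 0) = 0.
  by apply/funext => i; apply/funext => j; rewrite /shift_mat if_same.
by rewrite addr0 => ->; congr shift_mat; apply/funext => i; rewrite addr0.
Qed.

Lemma mat_mul_shift k l a b :
  mat_mul (shift_mat k a) (shift_mat l b)
  = shift_mat (k + l) (fun i => a i * b (i + k)).
Proof.
apply/funext => i; apply/funext => j; rewrite /mat_mul (fsum_single (i := i + k)).
  rewrite /shift_mat eqxx addrA; case: ifP => // _; exact: mulr0.
by move=> h /negbTE hi; rewrite {1}/shift_mat hi mul0r.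
Qed.

Lemma parity_part_shift e k a :
  parity_part e (shift_mat k a) = if odd `|k|%N == e then shift_mat k a else 0.
Proof.
apply/funext => i; apply/funext => j; rewrite /parity_part /shift_mat.
case: (j =P i + k) => [->|jik]; last by rewrite if_same; case: ifP => //;
  rewrite (introF eqP jik).
have -> : `|(i - (i + k))%R|%N = `|k|%N by lia.
by case: ifP => //; rewrite eqxx.
Qed.

Lemma mat_mul0 (A : mat K) : mat_mul A 0 = 0.
Proof.
apply/funext => i; apply/funext => j; rewrite /mat_mul (fsum_single (i := 0)).
  by rewrite mulr0.
by move=> h _; rewrite mulr0.
Qed.

Lemma mat_mul0l (A : mat K) : mat_mul 0 A = 0.
Proof.
apply/funext => i; apply/funext => j; rewrite /mat_mul (fsum_single (i := 0)).
  by rewrite mul0r.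
by move=> h _; rewrite mul0r.
Qed.

Definition bracket_seq k l a b i : K :=
  a i * b (i + k) - (-1) ^+ (odd `|k|%N && odd `|l|%N) * (b i * a (i + l)).

Lemma sbracket_shift k l a b :
  sbracket (shift_mat k a) (shift_mat l b)
  = shift_mat (k + l) (bracket_seq k l a b).
Proof.
rewrite /sbracket mat_mul_shift (bigD1 (odd `|k|%N))//= (bigD1 (odd `|l|%N))//=.
rewrite [X in - (_ + X)]big1 ?addr0; last first.
  move=> e /negbTE; rewrite eq_sym => ek.
  rewrite big1// => f _.
  by rewrite !parity_part_shift ek mat_mul0 scaler0.
rewrite [X in - (_ + X)]big1 ?addr0; last first.
  move=> f /negbTE; rewrite eq_sym => fl.
  by rewrite parity_part_shift fl mat_mul0l scaler0.
rewrite !parity_part_shift !eqxx mat_mul_shift (addrC l) shift_matZ shift_matB.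
by congr shift_mat.
Qed.

Lemma Jmat_shift : Jmat = shift_mat 0 (fun i => (i <= 0)%R%:R : K).
Proof.
apply/funext => i; apply/funext => j; rewrite /Jmat /shift_mat addr0 eq_sym.
by case: eqP.
Qed.

Lemma alpha_shift_neq k l a b :
  k + l != 0 -> alpha (shift_mat k a) (shift_mat l b) = 0.
Proof.
move=> kl; rewrite /alpha Jmat_shift sbracket_shift mat_mul_shift /Str.
rewrite (fsum_single (i := 0)) /shift_mat.
  by rewrite ifN ?mulr0// add0r add0r eq_sym.
move=> i _; rewrite ifN ?mulr0// add0r -subr_eq0 opprD addrA subrr sub0r.
by rewrite oppr_eq0.
Qed.

(* The cocycle only sees the entries at (i, i + k) separated by the origin. *)
Lemma alpha_shift0 k a b :
  (forall i, (i <= 0) != (i + k <= 0) -> a i * b (i + k) = 0) ->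
  alpha (shift_mat k a) (shift_mat (- k) b) = 0.
Proof.
move=> ab0; rewrite /alpha Jmat_shift sbracket_shift mat_mul_shift /Str.
have E i : (-1) ^+ odd `|i|%N * shift_mat (0 + k - k)
  (fun i => bracket_seq 0 k (fun i => (i <= 0)%R%:R) a i * b (i + (0 + k))) i i = 0.
  rewrite /shift_mat add0r subrr addr0 eqxx /bracket_seq /= expr0 mul1r addr0.
  have := ab0 i; case: (i <= 0); case: (i + k <= 0) => //= H.
  - by rewrite mul1r mulr1 subrr mul0r mulr0.
  - by rewrite mul1r mulr0 subr0 H// mulr0.
  - by rewrite mul0r mulr1 sub0r mulNr H// oppr0 mulr0.
  - by rewrite mul0r mulr0 subrr mul0r mulr0.
by rewrite (fsum_single (i := 0)) => [|i _]; exact: E.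
Qed.

(* Invariance of the form reads, on the entries a i at (i, i + k), as           *)
(* [twisted k a]: see [in_C_shift] and [shift_in_C].                           *)
Definition twist k i : K :=
  (-1) ^+ (odd `|k|%N && odd `|(i + k)%R|%N) *
  (form_basis i (- i) * form_basis (i + k) (- (i + k))).

Definition twisted k a := forall i, a (- i - k) = - twist k i * a i.

Lemma form_basis0 : form_basis 0 (- 0) = 0 :> K.
Proof. by rewrite /form_basis oppr0 eqxx. Qed.

Lemma form_basis_sqr i : form_basis i (- i) * form_basis i (- i) = (i != 0)%R%:R :> K.
Proof.
have [->|i0] := eqVneq i 0; first by rewrite form_basis0 mul0r.
rewrite /form_basis opprK eqxx; case: ifP => _; first by rewrite mul1r.
by case: sgrP i0 => // _ _; rewrite ?rmorphN ?mulrNN rmorph1 mulr1.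
Qed.

Lemma form_basisN i :
  form_basis (- i) (- - i) = - (-1) ^+ odd `|i|%N * form_basis i (- i) :> K.
Proof.
rewrite /form_basis !opprK !eqxx abszN; case: (odd `|i|%N).
  by rewrite expr1 opprK mulr1.
by rewrite expr0 mulN1r sgrN rmorphN.
Qed.

Lemma twistN k i : twist k (- i - k) = twist k i.
Proof.
rewrite /twist subrK form_basisN -opprD form_basisN.
have -> : odd `|- i|%N = odd `|i|%N by rewrite abszN.
rewrite odd_abszD.
case: (odd `|i|%N); case: (odd `|k|%N); rewrite /= ?expr0 ?expr1; ring.
Qed.

(** The value of the form at the middle index i + l occurs twice; its square is 1, or 0 when that
    index is 0. *)
Lemma twist_bracket k l i :
  twist k (i + l) * twist l i
  = (-1) ^+ (odd `|k|%N && odd `|l|%N) * twist (k + l) i * (i + l != 0)%R%:R.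
Proof.
rewrite -form_basis_sqr /twist -!addrA (addrC l k) !odd_abszD.
case: (odd `|i|%N); case: (odd `|k|%N); case: (odd `|l|%N); rewrite /= ?expr0 ?expr1;
  ring.
Qed.

(** [twist k (- k)] contains the value of the form at index 0, which is 0. Hence being [twisted]
    forces row 0 to vanish, and likewise column 0 in [twisted0k], as [in_A] demands. *)
Lemma twisted0 k a : twisted k a -> a 0 = 0.
Proof.
move=> /(_ (- k)); rewrite opprK subrr => ->.
by rewrite /twist addNr form_basis0 !mulr0 oppr0 mul0r.
Qed.

Lemma twisted0k k a : twisted k a -> a (- k) = 0.
Proof.
move=> /(_ 0); rewrite oppr0 sub0r => ->.
by rewrite /twist form_basis0 mul0r mulr0 oppr0 mul0r.
Qed.

Lemma twisted_lin (c : K) k a b :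
  twisted k a -> twisted k b -> twisted k (fun i => c * a i + b i).
Proof. by move=> ak bk i; rewrite ak bk; ring. Qed.

(** The reflection i -> -i - (k + l) exchanges the two products of the superbracket. Their twists
    compose by [twist_bracket], and at its exceptional index the twisted sequence itself is 0. *)
Lemma twisted_bracket k l a b :
  twisted k a -> twisted l b -> twisted (k + l) (bracket_seq k l a b).
Proof.
move=> ak bl i; rewrite /bracket_seq.
have -> : a (- i - (k + l)) = - twist k (i + l) * a (i + l).
  by rewrite -ak; congr a; lia.
have -> : b (- i - (k + l) + k) = - twist l i * b i by rewrite -bl; congr b; lia.
have -> : b (- i - (k + l)) = - twist l (i + k) * b (i + k).
  by rewrite -bl; congr b; lia.
have -> : a (- i - (k + l) + l) = - twist k i * a i by rewrite -ak; congr a; lia.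
have Ea : twist k (i + l) * twist l i * a (i + l)
    = (-1) ^+ (odd `|k|%N && odd `|l|%N) * twist (k + l) i * a (i + l).
  rewrite twist_bracket; have [->|_] := eqVneq (i + l) 0.
    by rewrite (twisted0 ak) !mulr0.
  by rewrite mulr1.
have Eb : twist l (i + k) * twist k i * b (i + k)
    = (-1) ^+ (odd `|k|%N && odd `|l|%N) * twist (k + l) i * b (i + k).
  rewrite twist_bracket (addrC l k) andbC; have [->|_] := eqVneq (i + k) 0.
    by rewrite (twisted0 bl) !mulr0.
  by rewrite mulr1.
transitivity (twist k (i + l) * twist l i * a (i + l) * b i
  - (-1) ^+ (odd `|k|%N && odd `|l|%N)
    * (twist l (i + k) * twist k i * b (i + k)) * a i); first by ring.
rewrite Ea Eb; case: (_ && _); rewrite ?expr0 ?expr1; ring.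
Qed.

End Shift.

(** * Linear spans *)

Section Span.
Context {K : fieldType} {E : lmodType K}.
Implicit Types (S T : set E).

Lemma lspan_incl S : S `<=` lspan S.
Proof.
move=> x Sx; exists 1%N, (fun=> 1), (fun=> x); split=> //.
by rewrite big_ord1 scale1r.
Qed.

Lemma lspan_subspace S : subspace (lspan S).
Proof.
split.
  by exists 0%N, (fun=> 0), (fun=> 0); split => [[]//|]; rewrite big_ord0.
move=> a _ _ [n [c [s [sS ->]]]] [m [d [t [tS ->]]]].
exists (n + m)%N, (fun i => match fintype.split i with inl i => a * c i | inr j => d j end),
  (fun i => match fintype.split i with inl i => s i | inr j => t j end); split.
  by move=> i; case: (fintype.split i).
rewrite big_split_ord scaler_sumr /=; congr (_ + _); apply: eq_bigr => i _.
  by rewrite (unsplitK (inl i)) scalerA.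
by rewrite (unsplitK (inr i)).
Qed.

Lemma subspace_sum S I (r : seq I) (P : pred I) (F : I -> E) :
  subspace S -> (forall i, P i -> S (F i)) -> S (\sum_(i <- r | P i) F i).
Proof.
move=> [S0 SD] SF; elim/big_rec: _ => // i x Pi Sx.
by rewrite -[F i]scale1r; apply: SD => //; exact: SF.
Qed.

Lemma subspaceZ S (a : K) x : subspace S -> S x -> S (a *: x).
Proof. by move=> [S0 SD] Sx; rewrite -[_ *: _]addr0; exact: SD. Qed.

Lemma subspaceD S x y : subspace S -> S x -> S y -> S (x + y).
Proof. by move=> [S0 SD] Sx Sy; rewrite -[x]scale1r; exact: SD. Qed.

Lemma lspan_min S T : subspace T -> S `<=` T -> lspan S `<=` T.
Proof.
move=> Tsub ST _ [n [c [s [sS ->]]]]; apply: subspace_sum => // i _.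
by apply: subspaceZ => //; exact: ST.
Qed.

Lemma lspan_mono S T : S `<=` T -> lspan S `<=` lspan T.
Proof.
by move=> ST; apply: lspan_min (lspan_subspace _) _ => x /ST; exact: lspan_incl.
Qed.

End Span.

(** * Homogeneous components of the algebra *)

Section InC.
Context {K : fieldType}.
Implicit Types (k l i j : int) (a b : int -> K) (A : mat K).

Lemma subspace_banded : subspace [set A : mat K | banded A].
Proof.
split; first by exists 0%N.
move=> c A B [n An] [m Bm]; exists (maxn n m) => i j; rewrite gtn_max => /andP[ni mi].
transitivity (c * A i j + B i j : K) => //.
by rewrite An// Bm// mulr0 addr0.
Qed.

Lemma in_C_banded A : in_C A -> banded A.
Proof. by move: A; apply: (lspan_min subspace_banded) => A [[]]. Qed.

(** Invariance of the form, tested on the basis vectors of indices j and -i. *)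
Lemma skew_form_entries e A i j : i != 0 -> j != 0 -> skew_form e A ->
  A i j * form_basis i (- i)
  = - (-1) ^+ (e && odd `|j|%N) * (A (- j) (- i) * form_basis j (- j)).
Proof.
move=> i0 j0 /(_ (odd `|j|%N) (unit_vec j) (unit_vec (- i)) (in_V_delta j0)).
rewrite !formE (fsum_single (i := i)); last first.
  by move=> h hi; rewrite {2}/unit_vec eqr_opp (negbTE hi) mulr0 mul0r.
rewrite (fsum_single (i := j)); last first.
  by move=> h hj; rewrite {1}/unit_vec (negbTE hj) !mul0r.
rewrite !mat_act_delta /unit_vec !eqxx mulr1 mul1r; apply.
  by move=> h oh; rewrite (_ : h == j = false)//; apply: contraNF oh => /eqP->.
by apply: in_V_delta; rewrite oppr_eq0.
Qed.

Lemma in_C_twisted A i j : in_C A -> A (- j) (- i) = - twist (j - i) i * A i j.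
Proof.
move: A; apply: lspan_min => [|A [[_ A0] [e [Ae eA]]]].
  split=> [|c A B /= HA HB]; first by rewrite mulr0.
  transitivity (c * A (- j) (- i) + B (- j) (- i) : K) => //.
  transitivity (- twist (j - i) i * (c * A i j + B i j)); last by [].
  by rewrite HA HB; ring.
have [i0|i0] := eqVneq i 0; first by rewrite /= !A0 ?mulr0// i0 ?oppr0 eqxx ?orbT.
have [j0|j0] := eqVneq j 0; first by rewrite /= !A0 ?mulr0// j0 ?oppr0 eqxx ?orbT.
have [oe|oe] := eqVneq (odd `|(i - j)%R|%N) e; last first.
  rewrite /= !Ae ?mulr0//; have : odd `|(i - j)%R|%N = odd `|(-j - - i)%R|%N by lia.
  by move=> <-.
have := skew_form_entries i0 j0 eA.
rewrite /= /twist addrCA subrr addr0.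
have -> : odd `|(j - i)%R|%N = e by rewrite -oe; lia.
have := form_basis_sqr (K := K) j; rewrite j0 /= => jj H.
transitivity (A (- j) (- i) * (form_basis j (- j) * form_basis j (- j))).
  by rewrite jj mulr1.
transitivity (- (-1) ^+ (e && odd `|j|%N) * (A i j * form_basis i (- i))
  * form_basis j (- j)); last by ring.
rewrite H; case: (_ && _); rewrite ?expr0 ?expr1; ring.
Qed.

Lemma in_C_shift A k : in_C A -> twisted k (fun i => A i (i + k)).
Proof.
move=> AC i; have := in_C_twisted i (i + k) AC.
have -> : i + k - i = k by rewrite addrC addKr.
by rewrite subrK opprD.
Qed.

Lemma mat_act_shift k a (v : int -> K) i :
  mat_act (shift_mat k a) v i = a i * v (i + k).
Proof.
rewrite /mat_act (fsum_single (i := i + k)) /shift_mat ?eqxx// => j /negbTE->.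
by rewrite mul0r.
Qed.

Lemma shift_in_C k a : twisted k a -> in_C (shift_mat k a).
Proof.
move=> ak; apply: lspan_incl; split.
  split.
    exists `|k|%N => i j ij; rewrite /shift_mat ifN//.
    by apply/eqP => ji; move: ij; lia.
  move=> i j; rewrite /shift_mat; case: (j =P i + k) => // -> /orP[/eqP ->|].
    exact: twisted0 ak.
  by rewrite addr_eq0 => /eqP->; exact: twisted0k ak.
exists (odd `|k|%N); split.
  move=> i j; rewrite /shift_mat => ij; rewrite ifN//.
  by apply: contraNneq ij => ->; apply/eqP; congr (odd _); lia.
move=> f v w vV vf wV; rewrite !formE.
pose G i := v (i + k) * w (- i) * a i * form_basis i (- i).
transitivity (\sum_(i \in [set: int]) G i).
  by apply: eq_fsbigr => i _; rewrite mat_act_shift /G; ring.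
rewrite [in RHS](reindex_fsbigT (fun i => i + k)); last first.
  by exists (fun i => i - k) => i; rewrite ?addrK ?subrK.
rewrite mulr_fsumr.
apply: eq_fsbigr => i _; rewrite mat_act_shift.
have [vf0|vf0] := eqVneq (odd `|(i + k)%R|%N) f; last first.
  by rewrite /G vf// !mul0r mulr0.
have -> : a (- (i + k)) = - twist k i * a i by rewrite opprD ak.
have -> : - (i + k) + k = - i by rewrite opprD subrK.
rewrite /G /twist vf0.
have [ik0|ik0] := eqVneq (i + k) 0.
  by rewrite (_ : v (i + k) = 0) ?mul0r ?mulr0// ik0; case: vV.
have := form_basis_sqr (K := K) (i + k); rewrite ik0 /= => jj.
transitivity (v (i + k) * w (- i) * a i * form_basis i (- i)
   * (form_basis (i + k) (- (i + k)) * form_basis (i + k) (- (i + k)))).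
  by rewrite jj mulr1.
case: (_ && _); rewrite ?expr0 ?expr1; ring.
Qed.

Lemma Chat_shiftP k (x : hmat K) : Chat_ k x <->
  exists a, [/\ x.1 = shift_mat k a, twisted k a & k != 0 -> x.2 = 0].
Proof.
split=> [[xC [xk x2]]|[a [xa ak x2]]].
  exists (fun i => x.1 i (i + k)); split=> //; first exact: mat_degree_shift.
  exact: in_C_shift.
split; first by rewrite /in_Chat /= xa; exact: shift_in_C.
by split=> //; rewrite xa; exact: shift_mat_degree.
Qed.

Lemma Chat_parity k (x : hmat K) : Chat_ k x -> hmat_parity (odd `|k|%N) x.
Proof.
move=> [_ [xk x2]]; split=> [i j ij|k1].
  by apply: xk; apply: contraNneq ij => ->; apply/eqP; congr (odd _); lia.
by apply: x2; apply: contraTneq k1 => ->.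
Qed.

Lemma Chat_bracket k l (x y : hmat K) :
  Chat_ k x -> Chat_ l y -> Chat_ (k + l) (hbracket x y).
Proof.
move=> /Chat_shiftP[a [xa ak _]] /Chat_shiftP[b [yb bl _]]; apply/Chat_shiftP.
exists (bracket_seq k l a b); rewrite /= xa yb sbracket_shift; split=> //.
  exact: twisted_bracket.
exact: alpha_shift_neq.
Qed.

Lemma subspace_Chat k : subspace (Chat_ k : set (hmat K)).
Proof.
split.
  apply/Chat_shiftP; exists (fun=> 0); split => //.
    by apply/funext => i; apply/funext => j; rewrite /shift_mat if_same.
  by move=> i; rewrite mulr0.
move=> c x y /Chat_shiftP[a [xa ak x2]] /Chat_shiftP[b [yb bk y2]].
apply/Chat_shiftP; exists (fun i => c * a i + b i); split.
- by rewrite /= xa yb shift_matP.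
- exact: twisted_lin.
- by move=> k0; rewrite /= x2// y2// scaler0 addr0.
Qed.

(** A band of width n leaves only the degrees from -n to n; the central term goes with degree 0. *)
Lemma Chat_decomp (x : hmat K) : in_Chat x ->
  exists (n : nat) (y : 'I_n -> hmat K) (k : 'I_n -> int),
    (forall h, Chat_ (k h) (y h)) /\ x = \sum_i y i.
Proof.
case: x => A c /= AC; have [n /= An] := in_C_banded AC.
pose k (h : 'I_(n.*2.+1)) : int := h%:Z - n%:Z.
exists n.*2.+1, (fun h => (shift_mat (k h) (fun i => A i (i + k h)),
   if k h == 0 then c else 0)), k; split.
  move=> h; apply/Chat_shiftP; eexists; split=> //=; first exact: in_C_shift.
  by move=> /negbTE->.
apply/eqP; rewrite -pair_eqE; apply/andP; split; apply/eqP.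
  rewrite /= (raddf_sum fst) /=; apply/funext => i; apply/funext => j.
  have E (F : 'I_n.*2.+1 -> mat K) : (\sum_h F h) i j = \sum_h F h i j.
    by elim/big_rec2: _ => // h u w _ <-.
  rewrite E; have [ij|ij] := ltnP n `|i - j|%N.
    rewrite An// big1// => h _; rewrite /shift_mat; case: eqP => // jE.
    by rewrite -jE An.
  have hlt : (`|(j - i + n%:Z)%R| < n.*2.+1)%N by lia.
  rewrite (bigD1 (Ordinal hlt))//= /shift_mat {1}/k /= ifT; last by apply/eqP; lia.
  rewrite big1 ?addr0; first by congr (A i _); rewrite /k /=; lia.
  move=> h hn; rewrite ifN//; apply: contraNneq hn => jE; apply/eqP/val_inj => /=.
  by rewrite jE /k; lia.
have hlt : (n < n.*2.+1)%N by lia.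
rewrite /= (raddf_sum snd) /= (bigD1 (Ordinal hlt))//= {1}/k /= subrr eqxx big1 ?addr0// => h hn.
rewrite ifN//; apply: contraNneq hn => kh; apply/eqP/val_inj => /=.
by move: kh; rewrite /k; lia.
Qed.

End InC.

(** * Matrices supported far from the origin *)

Section Far.
Context {K : fieldType}.
Implicit Types (k l i j N : int) (x y : hmat K).

Definition far N (A : mat K) := forall i j,
  ~~ ((N < i) && (N < j) || (i < - N) && (j < - N)) -> A i j = 0.

Lemma far_shift N k (a : int -> K) i : far N (shift_mat k a) ->
  ~~ ((N < i) && (N < i + k) || (i < - N) && (i + k < - N)) -> a i = 0.
Proof. by move=> /(_ i (i + k)) H /H; rewrite /shift_mat eqxx. Qed.

Lemma far_le N N' (A : mat K) : N' <= N -> far N A -> far N' A.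
Proof. by move=> NN' AN i j ij; apply: AN; lia. Qed.

(** A factor of degree [m] moves indices by [m]. If m < 0 this costs |m| in the threshold; if 0 <= m
    <= k it costs nothing, because the bracket still has nonpositive degree. *)
Lemma far_bracket N N' k m x y : Chat_ m y -> Chat_ (- k) x -> far N x.1 ->
  0 <= k -> m <= k -> N' <= N -> N' <= N + m -> far N' (hbracket y x).1.
Proof.
move=> /Chat_shiftP[b [yb bm _]] /Chat_shiftP[a [xa ak _]].
rewrite /= yb xa sbracket_shift => xN k0 mk NN' NmN' i j ij.
rewrite /shift_mat; case: (j =P _) => // jE; rewrite /bracket_seq.
have -> : a (i + m) = 0 by apply: far_shift xN _; move: ij; rewrite jE; lia.
have [->|ai] := eqVneq (a i) 0; first by rewrite mul0r !mulr0 subrr.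
by move: ai; rewrite (far_shift xN) ?eqxx//; move: ij; rewrite jE; lia.
Qed.

(** A far matrix has no entry joining the two sides of the origin, and the cocycle sees only
    those. *)
Lemma far_bracket_snd N k x y : Chat_ k y -> Chat_ (- k) x -> far N x.1 ->
  0 <= N -> (hbracket y x).2 = 0.
Proof.
move=> /Chat_shiftP[b [yb bm _]] /Chat_shiftP[a [xa ak _]] + N0.
rewrite /= yb xa => xN; apply: alpha_shift0 => i ik.
by rewrite (far_shift xN) ?mulr0//; move: ik; lia.
Qed.

Definition grading_elt : hmat K := Chat0_elt (fun n => n%:R) 0.

Lemma grading_elt_shift : grading_elt.1 = shift_mat 0 (fun i => i%:~R).
Proof.
apply/funext => i; apply/funext => j; rewrite /shift_mat addr0 /= eq_sym.
case: eqP => // _; rewrite pmulrn -rmorphM /=; congr (_%:~R); lia.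
Qed.

Lemma Chat0_grading_elt : Chat_ 0 grading_elt.
Proof. by rewrite Chat0P; exists (fun n => n%:R), 0. Qed.

Lemma grading_bracket k x : k != 0 -> Chat_ k x ->
  hbracket grading_elt x = (- k%:~R) *: x.
Proof.
move=> k0 /Chat_shiftP[a [xa ak x2]].
rewrite /hbracket xa grading_elt_shift sbracket_shift alpha_shift_neq ?add0r//.
apply: injective_projections => /=; last by rewrite x2// scaler0.
rewrite xa /= shift_matZ; congr shift_mat; apply/funext => i.
by rewrite /bracket_seq /= expr0 mul1r addr0 rmorphD /=; ring.
Qed.

End Far.

(** * Symmetrization, and raising and lowering elements *)

Section TwistSym.
Context {K : numFieldType}.
Implicit Types (k l i j N : int) (a b : int -> K).

Lemma twist_sqr k i : twist k i * twist k i = ((i != 0) && (i + k != 0))%R%:R :> K.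
Proof.
transitivity ((i != 0)%R%:R * (i + k != 0)%R%:R : K); last first.
  by case: (i == 0); case: (i + k == 0); rewrite /= ?mulr0 ?mulr1.
rewrite -!form_basis_sqr /twist; case: (_ && _); rewrite ?expr0 ?expr1; ring.
Qed.

Lemma twist_cube k i : twist k i * twist k i * twist k i = twist k i :> K.
Proof.
rewrite twist_sqr /twist; have [->|i0] := eqVneq i 0.
  by rewrite form_basis0 !(mul0r, mulr0).
by have [->|ik0] := eqVneq (i + k) 0; rewrite ?mul1r// form_basis0 !mulr0.
Qed.

(** Twice the projection of all sequences onto the [twisted] ones: see [twist_sym_twisted] and
    [twist_sym_id]. *)
Definition twist_sym k a i : K :=
  twist k i * twist k i * a i - twist k i * a (- i - k).

Lemma twist_sym_twisted k a : twisted k (twist_sym k a).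
Proof.
move=> i; rewrite /twist_sym twistN (_ : - (- i - k) - k = i); last lia.
rewrite -[X in _ - X * a i]twist_cube; ring.
Qed.

Lemma twist_sym_id k a i : twisted k a -> twist_sym k a i = 2 * a i.
Proof.
move=> ak; rewrite /twist_sym ak.
have E : a i = - twist k i * a (- i - k).
  by rewrite -{1}(twistN k i) -ak; congr a; lia.
have -> : twist k i * twist k i * a i = a i.
  by rewrite E mulrA mulrN twist_cube.
rewrite -ak [a (- i - k)]ak mulrA mulrN mulNr.
have -> : twist k i * twist k i * a i = a i.
  by rewrite E mulrA mulrN twist_cube.
by rewrite opprK mulr_natl mulr2n.
Qed.

Lemma hmat_sumE n (c : 'I_n -> K) (x : 'I_n -> hmat K) i j :
  (\sum_h c h *: x h).1 i j = \sum_h c h * (x h).1 i j.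
Proof. by elim/big_rec2: _ => // h u w _ <-. Qed.

Definition sym_unit k i : hmat K := (shift_mat k (twist_sym k (unit_vec i)), 0).

Lemma Chat_sym k a : Chat_ k (shift_mat k (twist_sym k a), 0 : K).
Proof. by apply/Chat_shiftP; eexists; split=> //; exact: twist_sym_twisted. Qed.

Lemma Chat_far_finite (k N : nat) : exists (n : nat) (t : 'I_n -> hmat K),
  (forall h, Chat_ (- k%:Z) (t h)) /\ forall x, Chat_ (- k%:Z) x ->
    exists c : 'I_n -> K, far N%:Z (x - \sum_h c h *: t h).1.
Proof.
(* The indices from -N to N + k are those where degree -k can fail to be far. This window is stable
   under the reflection i -> k - i, so both terms of [twist_sym] stay inside it. *)
pose n := (N.*2 + k).+1; pose r (h : 'I_n) : int := h%:Z - N%:Z.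
exists n, (fun h => sym_unit (- k%:Z) (r h)); split=> [h|x].
  exact: Chat_sym.
move=> /Chat_shiftP[a [xa ak _]]; exists (fun h => a (r h) / 2) => i j ij.
have S : (\sum_h (a (r h) / 2) *: sym_unit (- k%:Z) (r h)).1 i j = x.1 i j.
  rewrite hmat_sumE xa /= /shift_mat; case: (j =P i - k%:Z) => [jE|_]; last first.
    by rewrite big1// => h _; rewrite mulr0.
  have U i' : - N%:Z <= i' <= N%:Z + k%:Z ->
      \sum_h (a (r h) / 2) * unit_vec (r h) i' = a i' / 2.
    move=> ri; have hlt : (`|(i' + N%:Z)%R| < n)%N by rewrite /n; lia.
    rewrite (bigD1 (Ordinal hlt))//= /unit_vec big1 ?addr0.
      rewrite (_ : r _ = i') ?eqxx ?mulr1// /r /=; lia.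
    move=> h hn; rewrite (_ : (i' == r h) = false) ?mulr0//.
    apply: contraNF hn => /eqP i'E; apply/eqP/val_inj => /=.
    by rewrite i'E /r; lia.
  transitivity (twist_sym (- k%:Z) (fun i' => \sum_h (a (r h) / 2) * unit_vec (r h) i') i).
    rewrite /twist_sym !mulr_sumr -sumrB; apply: eq_bigr => h _; ring.
  rewrite /twist_sym !U; [|lia|lia].
  apply: (@mulfI _ 2); first by rewrite pnatr_eq0.
  rewrite -(twist_sym_id i ak).
  transitivity ((2 * 2^-1) * twist_sym (- k%:Z) a i : K); first by rewrite /twist_sym; ring.
  by rewrite mulfV ?mul1r// pnatr_eq0.
transitivity (x.1 i j - (\sum_h (a (r h) / 2) *: sym_unit (- k%:Z) (r h)).1 i j : K) => //.
by rewrite S subrr.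
Qed.

Lemma Chat0_eq (x y : hmat K) : Chat_ 0 x -> Chat_ 0 y -> x.2 = y.2 ->
  (forall n : nat, (0 < n)%N -> x.1 n%:Z n%:Z = y.1 n%:Z n%:Z) -> x = y.
Proof.
rewrite Chat0P => -[a [d ->]] [b [e ->]] /= -> ab; congr pair.
apply/funext => i; apply/funext => j; case: eqP => // _.
have [->|i0] := eqVneq i 0; first by rewrite sgr0 !mul0r.
have := ab `|i|%N; rewrite absz_gt0 i0 !eqxx => /(_ isT).
rewrite gtr0_sg ?mulr1z; last by lia.
by rewrite !mul1r => ->.
Qed.

Lemma Chat0_elt_in (a : nat -> K) d : Chat_ 0 (Chat0_elt a d).
Proof. by rewrite Chat0P; exists a, d. Qed.

Lemma Chat0_eltP (c : K) (a b : nat -> K) d e :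
  c *: Chat0_elt a d + Chat0_elt b e = Chat0_elt (fun n => c * a n + b n) (c * d + e).
Proof.
apply: Chat0_eq; try exact: Chat0_elt_in; try by [].
  by case: (subspace_Chat (K := K) 0) => _; apply; exact: Chat0_elt_in.
move=> n n0.
transitivity (c * (Chat0_elt a d).1 n%:Z n%:Z + (Chat0_elt b e).1 n%:Z n%:Z : K) => //.
by rewrite /= eqxx gtr0_sg// mulr1z !mul1r.
Qed.

(** The cutoffs here and in [lower] keep the sequence and its reflection on opposite sides of the
    origin, so that [twist_sym] preserves the values at positive indices instead of doubling
    them. *)
Definition raise b : hmat K :=
  (shift_mat 1 (twist_sym 1 (fun i => if 0 < i then b i else 0)), 0).

Definition lower b : hmat K :=
  (shift_mat (- 1) (twist_sym (- 1) (fun i => if 1 < i then b i else 0)), 0).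

Lemma twist_sym_raise b i : 0 < i ->
  twist_sym 1 (fun i => if 0 < i then b i else 0) i = b i.
Proof.
move=> i0; rewrite /twist_sym i0 ifF ?mulr0 ?subr0 ?twist_sqr; last by lia.
by rewrite (_ : _ && _)%R ?mul1r//; lia.
Qed.

Lemma twist_sym_lower b i : 0 < i ->
  twist_sym (- 1) (fun i => if 1 < i then b i else 0) i = if 1 < i then b i else 0.
Proof.
move=> i0; rewrite /twist_sym [X in _ - _ * X]ifF ?mulr0 ?subr0 ?twist_sqr; last by lia.
case: ifP => i1; last by rewrite mulr0.
by rewrite (_ : _ && _)%R ?mul1r//; lia.
Qed.

(** Both elements are odd, hence the plus sign. Only the pair (0, 1) could contribute to the
    cocycle, and row 0 is zero. *)
Lemma raise_lower b p : hbracket (raise b) (lower p) = Chat0_elt (fun n =>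
  b n%:Z * p (n%:Z + 1) + (if (1 < n)%N then p n%:Z * b (n%:Z - 1) else 0)) 0.
Proof.
have rb : Chat_ 1 (raise b) by exact: Chat_sym.
have lp : Chat_ (- 1) (lower p) by exact: Chat_sym.
apply: Chat0_eq.
- by have := Chat_bracket rb lp; rewrite subrr.
- exact: Chat0_elt_in.
- rewrite /= alpha_shift0// => i i1; have -> : i = 0 by lia.
  by rewrite (twisted0 (twist_sym_twisted 1 _)) mul0r.
move=> n n0; rewrite /= sbracket_shift /shift_mat subrr addr0 eqxx gtr0_sg// mulr1z mul1r.
rewrite /bracket_seq /= expr1 mulN1r opprK twist_sym_raise// twist_sym_lower; last lia.
rewrite ifT; last by lia.
congr (_ + _); rewrite twist_sym_lower//.
case: ifP => n1; last by rewrite ifF ?mul0r//; lia.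
by rewrite ifT ?twist_sym_raise//; lia.
Qed.

End TwistSym.

(** * Linear dependence, roots and eigenvectors *)

Lemma lspan_seq (K : fieldType) (E : lmodType K) (s : seq E) u :
  lspan [set` s] u -> exists c : 'I_(size s) -> K, u = \sum_i c i *: s`_i.
Proof.
move: u; apply: lspan_min => [|u /= us].
  split=> [|a _ _ [c ->] [d ->]].
    by exists (fun=> 0); rewrite big1// => i _; rewrite scale0r.
  exists (fun i => a * c i + d i); rewrite scaler_sumr -big_split.
  by apply: eq_bigr => i _; rewrite scalerDl scalerA.
have ilt : (index u s < size s)%N by rewrite index_mem.
exists (fun i => (i == Ordinal ilt)%:R); rewrite (bigD1 (Ordinal ilt))//= eqxx.
rewrite scale1r nth_index// big1 ?addr0// => i /negbTE->.
by rewrite scale0r.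
Qed.

(** One vector more than generators forces a relation. Its coefficients are packaged as a polynomial
    so that the relation among powers becomes a polynomial in the index. *)
Lemma lspan_dependent (K : fieldType) (E : lmodType K) (s : seq E) (u : nat -> E) :
  (forall i, lspan [set` s] (u i)) ->
  exists2 p : {poly K}, p != 0 & \sum_(i < size p) p`_i *: u i = 0.
Proof.
move=> us; have /choice[c uE] i := lspan_seq (us i).
pose A := \matrix_(i < (size s).+1, j < size s) c i j.
have kA : kermx A != 0.
  rewrite -mxrank_eq0 mxrank_ker -lt0n subn_gt0.
  by apply: leq_ltn_trans (rank_leq_col A) _.
have /rowV0Pn[r /sub_kermxP rA r0] := kA.
exists (\poly_(i < (size s).+1) r 0 (inord i)).
  apply: contra_neq r0 => p0; apply/rowP => i.
  have := congr1 (fun p : {poly K} => p`_i) p0.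
  by rewrite coef_poly coef0 ltn_ord inord_val mxE.
set p := \poly_(_ < _) _.
have -> : \sum_(i < size p) p`_i *: u i = \sum_(i < (size s).+1) p`_i *: u i.
  rewrite (big_ord_widen _ (fun i => p`_i *: u i) (size_poly _ _)) big_mkcond /=.
  by apply: eq_bigr => i _; case: ltnP => // pi; rewrite nth_default ?scale0r.
transitivity (\sum_j (r *m A) 0 j *: s`_j); last first.
  by rewrite rA big1// => j _; rewrite mxE scale0r.
transitivity (\sum_(i < (size s).+1) \sum_j (r 0 i * c i j) *: s`_j).
  apply: eq_bigr => i _; rewrite uE scaler_sumr; apply: eq_bigr => j _.
  by rewrite scalerA coef_poly ltn_ord inord_val.
rewrite exchange_big; apply: eq_bigr => j _; rewrite mxE scaler_suml.
by apply: eq_bigr => i _; rewrite mxE.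
Qed.

Lemma poly_natr_eventually_neq0 (K : numFieldType) (p : {poly K}) : p != 0 ->
  exists n0 : nat, forall n, (n0 < n)%N -> p.[n%:R] != 0.
Proof.
have [m] := ubnP (size p); elim: m p => // m IH p pm p0.
have [[n /factor_theorem[q pE]]|noroot] := pselect (exists n : nat, root p n%:R);
  last first.
  by exists 0%N => n _; apply/negP => pn; apply: noroot; exists n.
have q0 : q != 0 by apply: contra_neq p0 => q0; rewrite pE q0 mul0r.
have [|n0 qn] := IH q _ q0.
  by move: pm; rewrite pE size_Mmonic ?monicXsubC// size_XsubC addn2.
exists (maxn n0 n) => h; rewrite gtn_max => /andP[n0h nh].
rewrite pE hornerM mulf_neq0 ?qn// hornerXsubC subr_eq0 eqr_nat.
by rewrite gtn_eqF.
Qed.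

Lemma eigenvector_span (K : fieldType) (M : lmodType K) (T : M -> M) (l : K)
    (n : nat) (c mu : 'I_n -> K) (s : 'I_n -> M) :
  (forall (a : K) u w, T (a *: u + w) = a *: T u + T w) ->
  (forall i, T (s i) = mu i *: s i) -> (forall i, mu i != l) ->
  T (\sum_i c i *: s i) = l *: (\sum_i c i *: s i) -> \sum_i c i *: s i = 0.
Proof.
move=> Tlin; have T0 : T 0 = 0.
  have := Tlin 1 0 0; rewrite !scale1r addr0 => H.
  by apply: (addrI (T 0)); rewrite addr0 -H.
elim: n c mu s => [|n IH] c mu s Ts mul; first by rewrite big_ord0.
set w := \sum_i _ => Tw.
have Tsum : T w = \sum_i c i *: (mu i *: s i).
  rewrite /w; elim/big_rec2: _ => // i u u' _ <-; by rewrite Tlin Ts.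
pose m := mu ord_max.
have lm : l - m != 0 by rewrite subr_eq0 eq_sym; exact: mul.
(* Applying [T - m] multiplies [w] by l - m and kills the last summand. *)
have E : (l - m) *: w
    = \sum_(i < n) (c (widen_ord (leqnSn n) i) * (mu (widen_ord (leqnSn n) i) - m))
        *: s (widen_ord (leqnSn n) i).
  rewrite scalerBl -Tw Tsum /w scaler_sumr -sumrB big_ord_recr /=.
  rewrite !scalerA (mulrC _ m) subrr addr0; apply: eq_bigr => i _.
  by rewrite !scalerA -scalerBl mulrBr (mulrC m).
have {}E : w = \sum_(i < n) ((l - m)^-1 * (c (widen_ord (leqnSn n) i)
    * (mu (widen_ord (leqnSn n) i) - m))) *: s (widen_ord (leqnSn n) i).
  rewrite -[LHS]scale1r -(mulVf lm) -scalerA E scaler_sumr.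
  by apply: eq_bigr => i _; rewrite scalerA.
rewrite E; apply: (IH _ (fun i => mu (widen_ord (leqnSn n) i))) => //.
by rewrite -E.
Qed.

(** * The graded superalgebra acting on a module *)

Section ModuleTheory.
Context {K : numFieldType} {M : lmodType K} {Mp : bool -> set M}
  {act : hmat K -> M -> M}.
Hypothesis M_module : Chat_module Mp act.
Implicit Types (x y : hmat K) (u w : M).

Lemma Chat_in k x : Chat_ k x -> in_Chat x.
Proof. by case. Qed.

Lemma actP x (a : K) u w : in_Chat x -> act x (a *: u + w) = a *: act x u + act x w.
Proof. by case: M_module => _ + _ _ _; exact. Qed.

Lemma act0 x : in_Chat x -> act x 0 = 0.
Proof.
move=> xC; have := actP 1 0 0 xC; rewrite !scale1r addr0 => H.
by apply: (addrI (act x 0)); rewrite addr0 -H.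
Qed.

Lemma actZ x (a : K) u : in_Chat x -> act x (a *: u) = a *: act x u.
Proof. by move=> xC; rewrite -[a *: u]addr0 actP// act0// addr0. Qed.

Lemma actD x u w : in_Chat x -> act x (u + w) = act x u + act x w.
Proof. by move=> xC; rewrite -[u]scale1r actP// !scale1r. Qed.

Lemma act_lin (a : K) x y u : in_Chat x -> in_Chat y ->
  act (a *: x + y) u = a *: act x u + act y u.
Proof. by case: M_module => _ _ + _ _; exact. Qed.

Lemma subspace_in_Chat : subspace (in_Chat : set (hmat K)).
Proof.
have [C0 CD] := lspan_subspace
  [set A : mat K | in_A A /\ exists e, mat_parity e A /\ skew_form e A].
by split=> // a x y; exact: CD.
Qed.

Lemma act0l u : act 0 u = 0.
Proof.
have C0 : in_Chat (0 : hmat K) by case: subspace_in_Chat.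
have := act_lin 1 u C0 C0; rewrite !scale1r addr0 => H.
by apply: (addrI (act 0 u)); rewrite addr0 -H.
Qed.

Lemma act_suml n (x : 'I_n -> hmat K) (c : 'I_n -> K) u :
  (forall i, in_Chat (x i)) ->
  act (\sum_i c i *: x i) u = \sum_i c i *: act (x i) u.
Proof.
move=> xC; suff [] : in_Chat (\sum_i c i *: x i) /\
    act (\sum_i c i *: x i) u = \sum_i c i *: act (x i) u by [].
have [C0 CD] := subspace_in_Chat.
elim/big_rec2: _ => [|i w y _ [yC <-]]; first by rewrite act0l.
by split; [exact: CD | exact: act_lin].
Qed.

Lemma act_lspan x (S T : set M) : in_Chat x ->
  (forall u, S u -> lspan T (act x u)) -> forall u, lspan S u -> lspan T (act x u).
Proof.
move=> xC ST u; move: u; apply: lspan_min => //.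
have [T0 TD] := lspan_subspace T; split=> [|a u w uT wT] /=.
  by rewrite act0.
by rewrite actP//; exact: TD.
Qed.

Lemma act_Mp k x e u : Chat_ k x -> Mp e u -> Mp (odd `|k|%N (+) e) (act x u).
Proof.
move=> xk ue; case: M_module => _ _ _ + _; apply => //; first exact: Chat_in xk.
exact: Chat_parity.
Qed.

Lemma act_bracket k l x y u : Chat_ k x -> Chat_ l y ->
  act (hbracket x y) u = act x (act y u)
    - (-1) ^+ (odd `|k|%N && odd `|l|%N) *: act y (act x u).
Proof.
move=> xk yl; case: M_module => _ _ _ _; apply; try exact: Chat_parity.
  exact: Chat_in xk.
exact: Chat_in yl.
Qed.

Lemma act_swap k l x y u : Chat_ k x -> Chat_ l y ->
  act x (act y u) = act (hbracket x y) u
    + (-1) ^+ (odd `|k|%N && odd `|l|%N) *: act y (act x u).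
Proof. by move=> xk yl; rewrite (act_bracket u xk yl) subrK. Qed.

Lemma Mp_subspace e : subspace (Mp e).
Proof. by case: M_module => -[]. Qed.

Lemma Mp_split u : exists u0 u1, [/\ Mp false u0, Mp true u1 & u = u0 + u1].
Proof. by case: M_module => -[]. Qed.

Lemma Mp_uniq e u u' w w' : Mp e u -> Mp e u' -> Mp (~~ e) w -> Mp (~~ e) w' ->
  u + w = u' + w' -> u = u' /\ w = w'.
Proof.
move=> ue u'e we w'e E.
have B f (p q : M) : Mp f p -> Mp f q -> Mp f (p - q).
  move=> pf qf; rewrite addrC -scaleN1r.
  by case: (Mp_subspace f) => _; apply.
have D : u - u' = w' - w by apply/eqP; rewrite subr_eq addrAC eq_sym subr_eq E addrC.
have uu' : u - u' = 0.
  have P1 : Mp e (u - u') by exact: B.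
  have P2 : Mp (~~ e) (u - u') by rewrite D; exact: B.
  case: M_module => -[_ _ H] _ _ _ _.
  by case: e P1 P2 {ue u'e we w'e} => P1 P2; apply: H.
by split; apply/eqP; rewrite eq_sym -subr_eq0; [rewrite -oppr_eq0 opprB uu'|
  rewrite -D uu'].
Qed.

Lemma lspan_homogeneous (S : set M) : (forall u, S u -> exists e, Mp e u) ->
  forall u0 u1, Mp false u0 -> Mp true u1 -> lspan S (u0 + u1) ->
  lspan S u0 /\ lspan S u1.
Proof.
move=> SM u0 u1 u00 u11 [n [c [s [sS E]]]].
have /choice[e eM] i : exists e, Mp e (s i) := SM _ (sS i).
have D : u0 + u1 = (\sum_(i | e i == false) c i *: s i)
     + (\sum_(i | e i != false) c i *: s i) by rewrite E (bigID (fun i => e i == false)).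
have P0 : Mp false (\sum_(i | e i == false) c i *: s i).
  apply: subspace_sum => [|i /eqP ei]; first exact: Mp_subspace.
  by apply: subspaceZ (Mp_subspace _) _; rewrite -ei.
have P1 : Mp true (\sum_(i | e i != false) c i *: s i).
  apply: subspace_sum => [|i ei]; first exact: Mp_subspace.
  apply: subspaceZ (Mp_subspace _) _; rewrite -(_ : e i = true)//.
  by case: (e i) ei.
have [-> ->] := Mp_uniq u00 P0 u11 P1 D.
by split; apply: subspace_sum (lspan_subspace S) _ => i _;
  apply: subspaceZ (lspan_subspace S) _; apply: lspan_incl.
Qed.

(* The highest weight vector need not be parity-homogeneous, but its two       *)
(* components are vacua: see [highest_weight_split].                           *)
Definition vacuum (xi : hmat K -> K) w : Prop :=
  [/\ exists e, Mp e w, forall h, Chat_ 0 h -> act h w = xi h *: w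
    & forall k x, 0 < k -> Chat_ k x -> act x w = 0].

(** * The submodule generated by far elements acting on vacua *)

Section FarAnnihilation.
Variables (xi : hmat K -> K) (N : int).
Hypothesis N_ge0 : 0 <= N.
Hypothesis xi_far : forall h, Chat_ 0 h -> far N h.1 -> h.2 = 0 -> xi h = 0.

(** Words in lowering elements whose first letter to act is far; the number is the depth below the
    vacuum. By [far_desc_act] their span is stable under the other degrees too. *)
Inductive far_desc : nat -> M -> Prop :=
| far_desc0 k x w : vacuum xi w -> (0 < k)%N -> Chat_ (- k%:Z) x -> far N x.1 ->
    far_desc k (act x w)
| far_descS d k x u : far_desc d u -> (0 < k)%N -> Chat_ (- k%:Z) x ->
    far_desc (d + k) (act x u).

Definition far_span : set M := lspan [set u | exists d, far_desc d u].

Lemma far_span_lower (k : nat) x u : (0 < k)%N -> Chat_ (- k%:Z) x -> far_span u ->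
  far_span (act x u).
Proof.
move=> k0 xk; apply: act_lspan (Chat_in xk) _ _ => w [d wd].
by apply: lspan_incl; exists (d + k)%N; exact: far_descS.
Qed.

Lemma far_desc_act d u : far_desc d u ->
  forall m y, Chat_ m y -> far_span (act y u).
Proof.
have sub := lspan_subspace [set u | exists d, far_desc d u].
elim=> {d u} [k x w wv k0 xk xN|d k x u ud IH k0 xk] m y ym.
  have [m0|m0] := ltP m 0.
    apply: lspan_incl; exists (k + `|m|%N)%N.
    by apply: far_descS => //; [exact: far_desc0 | lia | have -> : - `|m|%N%:Z = m by lia].
  rewrite (act_swap w ym xk); have [_ w0 wp] := wv.
  apply: (subspaceD sub).
    have yx := Chat_bracket ym xk.
    (* The bracket is again far and lowering if m < k, and raising, so zero on [w], if m > k. If m =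
       k it is a far diagonal without central term, which [xi] kills. *)
    have [mk|mk|mk] := ltgtP m k%:Z.
    + apply: lspan_incl; exists (k - `|m|)%N; apply: far_desc0 => //; first lia.
        by rewrite (_ : - _ = m - k%:Z)//; lia.
      by apply: far_bracket ym xk xN _ _ _ _ => //; lia.
    + by rewrite (wp _ _ _ yx)//; [case: sub | lia].
    + rewrite mk subrr in yx; rewrite mk in ym.
      rewrite w0// xi_far ?scale0r//; first by case: sub.
        by apply: far_bracket ym xk xN _ _ _ _ => //; lia.
      exact: far_bracket_snd ym xk xN _.
  apply: (subspaceZ _ sub); have [m0'|m0'] := eqVneq m 0.
    rewrite w0; last by rewrite -m0'.
    rewrite (actZ _ _ (Chat_in xk)); apply: (subspaceZ _ sub).
    by apply: lspan_incl; exists k; exact: far_desc0.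
  by rewrite (wp _ _ _ ym) ?(act0 (Chat_in xk)); [case: sub|lia].
rewrite (act_swap u ym xk); apply: (subspaceD sub).
  exact: IH (Chat_bracket ym xk).
by apply: (subspaceZ _ sub); apply: far_span_lower k0 xk _; exact: IH ym.
Qed.

Lemma far_desc_Mp d u : far_desc d u -> exists e, Mp e u.
Proof.
elim=> {d u} [k x w [[e we] _ _] _ xk _|d k x u _ [e ue] _ xk].
  by eexists; exact: (act_Mp xk we).
by eexists; exact: (act_Mp xk ue).
Qed.

Lemma far_desc_grading d u : far_desc d u -> (0 < d)%N /\
  act grading_elt u = (xi grading_elt + d%:R) *: u.
Proof.
have step k x w c : (0 < k)%N -> Chat_ (- k%:Z) x -> act grading_elt w = c *: w ->
    act grading_elt (act x w) = (c + k%:R) *: act x w.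
  move=> k0 xk E; rewrite (act_swap w Chat0_grading_elt xk) /= scale1r E.
  rewrite (actZ _ _ (Chat_in xk)) (grading_bracket _ xk); last by lia.
  rewrite scalerDl addrC; congr (_ + _); rewrite -[_ *: x]addr0.
  have [C0 _] := subspace_in_Chat.
  rewrite (act_lin _ _ (Chat_in xk) C0) act0l addr0.
  by rewrite rmorphN opprK pmulrn.
elim=> {d u} [k x w [_ w0 _] k0 xk _|d k x u _ [d0 E] k0 xk].
  by split=> //; apply: step => //; apply: w0; exact: Chat0_grading_elt.
split; first by rewrite addn_gt0 d0.
by rewrite natrD addrA; exact: step.
Qed.

Lemma far_span_submodule : submodule Mp act far_span.
Proof.
split; first exact: lspan_subspace.
  by apply: lspan_homogeneous => u [d ud]; exact: far_desc_Mp ud.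
move=> x u /Chat_decomp[n [y [k [yk ->]]]] uW.
have -> : \sum_i y i = \sum_i 1 *: y i by apply: eq_bigr => i _; rewrite scale1r.
rewrite act_suml; last by move=> i; exact: Chat_in (yk i).
apply: subspace_sum (lspan_subspace _) _ => i _.
apply: subspaceZ (lspan_subspace _) _.
apply: act_lspan uW; first exact: Chat_in (yk i).
by move=> w [d wd]; exact: far_desc_act wd _ _ (yk i).
Qed.

(* Eigenvectors of the grading element for distinct eigenvalues are            *)
(* independent, and [far_span] only has eigenvalues other than that of u.      *)
Lemma far_span_vacuum u : act grading_elt u = xi grading_elt *: u ->
  far_span u -> u = 0.
Proof.
move=> Eu [n [c [s [sW uE]]]]; have /choice[d sd] := sW.
rewrite uE in Eu *.
apply: (eigenvector_span (T := act grading_elt) (l := xi grading_elt)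
  (mu := fun i => xi grading_elt + (d i)%:R)) => //.
- by move=> a w w'; apply: actP; exact: Chat_in Chat0_grading_elt.
- by move=> i; case: (far_desc_grading (sd i)).
- move=> i; case: (far_desc_grading (sd i)) => di _.
  by rewrite -subr_eq0 addrAC subrr add0r pnatr_eq0 -lt0n.
Qed.

(** By irreducibility [far_span] is zero or everything, and in the second case it would contain [v],
    contradicting [far_span_vacuum]. *)
Lemma far_annihilates_vacuum v (k : nat) x w : irreducible Mp act ->
  v != 0 -> act grading_elt v = xi grading_elt *: v ->
  vacuum xi w -> (0 < k)%N -> Chat_ (- k%:Z) x -> far N x.1 -> act x w = 0.
Proof.
move=> [_ /(_ _ far_span_submodule)] [W0|WT] v0 Ev wv k0 xk xN.
  have : far_span (act x w) by apply: lspan_incl; exists k; exact: far_desc0.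
  by rewrite W0.
by move: v0; rewrite (far_span_vacuum Ev) ?eqxx// WT.
Qed.

End FarAnnihilation.

(** * Highest weight vectors *)

Section HighestWeight.
Variables (xi : hmat K -> K) (v : M).
Hypothesis v_highest : highest_weight_vector act xi v.

(** A homogeneous element sends the even and odd parts of [v] to opposite parities, so each defining
    equation splits in two. *)
Lemma highest_weight_split : exists v0 v1,
  [/\ vacuum xi v0, vacuum xi v1 & v = v0 + v1].
Proof.
have [_ vh vp _] := v_highest; have [v0 [v1 [M0 M1 vE]]] := Mp_split v.
have h_split h : Chat_ 0 h -> act h v0 = xi h *: v0 /\ act h v1 = xi h *: v1.
  move=> h0; apply: (@Mp_uniq false).
  - exact: act_Mp h0 M0.
  - exact: subspaceZ (Mp_subspace _) M0.
  - exact: act_Mp h0 M1.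
  - exact: subspaceZ (Mp_subspace _) M1.
  - by rewrite -(actD _ _ (Chat_in h0)) -scalerDr -vE; exact: vh.
have p_split k x : 0 < k -> Chat_ k x -> act x v0 = 0 /\ act x v1 = 0.
  move=> k0 xk; apply: (@Mp_uniq (odd `|k|%N (+) false)).
  - exact: act_Mp xk M0.
  - by case: (Mp_subspace (odd `|k|%N (+) false)).
  - by rewrite -addbN; exact: act_Mp xk M1.
  - by case: (Mp_subspace (~~ (odd `|k|%N (+) false))).
  - by rewrite -(actD _ _ (Chat_in xk)) -vE addr0; exact: vp k0 xk.
exists v0, v1; split=> //; split.
- by exists false.
- by move=> h /h_split[].
- by move=> k x k0 /(p_split k x k0)[].
- by exists true.
- by move=> h /h_split[].
- by move=> k x k0 /(p_split k x k0)[].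
Qed.

Lemma far_annihilates N (k : nat) x : irreducible Mp act -> 0 <= N ->
  (forall h, Chat_ 0 h -> far N h.1 -> h.2 = 0 -> xi h = 0) ->
  (0 < k)%N -> Chat_ (- k%:Z) x -> far N x.1 -> act x v = 0.
Proof.
move=> irr N0 xiN k0 xk xN; have [v0 [v1 [vac0 vac1 vE]]] := highest_weight_split.
have [vn0 vh _ _] := v_highest.
have Ev : act grading_elt v = xi grading_elt *: v by apply: vh; exact: Chat0_grading_elt.
rewrite vE (actD _ _ (Chat_in xk)).
by rewrite !(far_annihilates_vacuum N0 xiN irr vn0 Ev _ k0 xk xN)// addr0.
Qed.

Inductive desc : nat -> M -> Prop :=
| desc0 : desc 0 v
| descS d k x u : desc d u -> (0 < k)%N -> Chat_ (- k%:Z) x -> desc (d + k) (act x u).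

Lemma hw_component_desc j : hw_component act v j `<=` lspan (desc j).
Proof.
apply: lspan_mono => _ [n [ks [xs [ksx <- ->]]]].
rewrite -big_enum; elim: (enum _) => [|i r IH] /=; first by rewrite big_nil; exact: desc0.
by rewrite big_cons addnC; have [k0 xk] := ksx i; exact: descS.
Qed.

(** Moving [x] past a letter of degree -l produces a bracket whose threshold has dropped by at most
    l; the margin [d] pays for all the letters. *)
Lemma far_annihilates_desc N : irreducible Mp act -> 0 <= N ->
  (forall h, Chat_ 0 h -> far N h.1 -> h.2 = 0 -> xi h = 0) ->
  forall d u, desc d u -> forall (k : nat) x,
  (0 < k)%N -> Chat_ (- k%:Z) x -> far (N + d%:Z) x.1 -> act x u = 0.
Proof.
move=> irr N0 xiN d u; elim=> {d u} [|d l y u _ IH l0 yl] k x k0 xk xN.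
  by apply: far_annihilates irr N0 xiN k0 xk _; rewrite addr0 in xN.
have := act_bracket u yl xk.
rewrite (IH k x)//; last by apply: far_le xN; lia.
rewrite (act0 (Chat_in yl)) (IH (l + k)%N (hbracket y x)); first last.
- by apply: far_bracket yl xk xN _ _ _ _; lia.
- by have := Chat_bracket yl xk; rewrite (_ : _ - _ = - (l + k)%N%:Z)//; lia.
- by lia.
move=> /eqP; rewrite sub0r eq_sym oppr_eq0 scaler_eq0 signr_eq0 /=.
by move=> /eqP.
Qed.

Lemma desc_fin_dim N j : irreducible Mp act ->
  (forall h, Chat_ 0 h -> far N%:Z h.1 -> h.2 = 0 -> xi h = 0) ->
  exists s : seq M, (forall u, u \in s -> desc j u) /\
    forall u, desc j u -> lspan [set` s] u.
Proof.
move=> irr xiN; elim/ltn_ind: j => j IH.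
(* Inner induction on a bound for the degree of the last letter to act. Modulo elements far enough
   to kill depth j - (b + 1), the letters of degree -(b + 1) are spanned by finitely many [t h]. *)
have [s [sj sP]] : exists s : seq M, (forall u, u \in s -> desc j u) /\
    forall (d k : nat) x u, desc d u -> (0 < k)%N -> (k <= j)%N -> (d + k = j)%N ->
      Chat_ (- k%:Z) x -> lspan [set` s] (act x u).
  have : (j <= j)%N by [].
  elim: {1 4}j => [_|b IHb bj]; first by exists [::]; split=> // d [].
  have [s [sj sP]] := IHb (ltnW bj).
  have [|s' [s'd s'P]] := IH (j - b.+1)%N; first by lia.
  have [n [t [tk tP]]] := Chat_far_finite (K := K) b.+1 (N + (j - b.+1)).
  exists ([seq act (t h) w | h <- enum 'I_n, w <- s'] ++ s); split=> [u|].
    rewrite mem_cat => /orP[/allpairsP[[h w] /= [_ ws' ->]]|]; last exact: sj.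
    by rewrite -(subnK bj); apply: descS (s'd _ ws') _ (tk h).
  move=> d k x u ud k0; rewrite leq_eqVlt => /orP[/eqP kb dk xk|kb dk xk]; last first.
    apply: lspan_mono (sP d k x u ud k0 kb dk xk) => w /= ws.
    by rewrite mem_cat ws orbT.
  have dE : d = (j - b.+1)%N by lia.
  move: ud => /[!dE] /s'P; apply: act_lspan; first exact: Chat_in xk.
  move=> w /= ws'; rewrite kb in xk; have [c xc] := tP x xk.
  set y := x - _ in xc.
  have yk : Chat_ (- b.+1%:Z) y.
    rewrite /y addrC -scaleN1r; have [_ CD] := subspace_Chat (K := K) (- b.+1%:Z).
    apply: CD xk; apply: subspace_sum (subspace_Chat _) _ => h _.
    by apply: subspaceZ (subspace_Chat _) _; exact: tk.
  have -> : x = 1 *: y + \sum_h c h *: t h by rewrite scale1r subrK.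
  have SC : in_Chat (\sum_h c h *: t h).
    apply: subspace_sum subspace_in_Chat _ => h _.
    by apply: subspaceZ subspace_in_Chat _; exact: Chat_in (tk h).
  rewrite (act_lin _ _ (Chat_in yk) SC) (far_annihilates_desc irr _ xiN (s'd _ ws') _ yk) //.
  rewrite scaler0 add0r act_suml; last by move=> h; exact: Chat_in (tk h).
  apply: subspace_sum (lspan_subspace _) _ => h _.
  apply: subspaceZ (lspan_subspace _) _; apply: lspan_incl => /=.
  by rewrite mem_cat allpairs_f// mem_enum.
exists ((if j == 0%N then [:: v] else [::]) ++ s); split=> u.
  rewrite mem_cat => /orP[|/sj//]; case: eqP => // -> /[!inE]/eqP->; exact: desc0.
move=> uj; have := sP; case: uj => [_|d k x w wd k0 xk H].
  by apply: lspan_incl; rewrite /= inE eqxx.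
apply: lspan_mono (H d k x w wd k0 (leq_addl _ _) erefl xk) => w' /= w's.
by rewrite mem_cat w's orbT.
Qed.

Lemma hw_component_fin_dim N : irreducible Mp act ->
  (forall h, Chat_ 0 h -> far N%:Z h.1 -> h.2 = 0 -> xi h = 0) ->
  quasi_finite act v.
Proof.
move=> irr xiN j; have [s [_ sP]] := desc_fin_dim j irr xiN.
exists s => u /hw_component_desc; apply: lspan_min; first exact: lspan_subspace.
exact: sP.
Qed.

Lemma fin_dim_weight : fin_dim [set act x v | x in Chat_ (- 1)] ->
  exists n0 : nat, forall c : nat -> K, (forall n, (n <= n0)%N -> c n = 0) ->
    xi (Chat0_elt c 0) = 0.
Proof.
move=> [s sP]; have [v0 vh vp _] := v_highest.
have lowerC a : Chat_ (- 1) (lower a : hmat K) by exact: Chat_sym.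
have [|p p0 pv] := @lspan_dependent _ _ s
  (fun m => act (lower (fun i => i%:~R ^+ m)) v).
  by move=> m; apply: sP; exists (lower (fun i => i%:~R ^+ m)).
have {pv}lv : act (lower (fun i => p.[i%:~R])) v = 0.
  rewrite -pv -act_suml; last by move=> i; exact: Chat_in (lowerC _).
  (* [lower] is linear in its sequence, so the relation among powers is the single element [lower]
     of the polynomial. *)
  congr act; apply: injective_projections.
    apply/funext => i; apply/funext => j.
    rewrite hmat_sumE /= /shift_mat; case: eqP => _; last first.
      by rewrite big1// => h _; rewrite mulr0.
    under eq_bigr => h _ do rewrite /twist_sym.
    rewrite /twist_sym; case: ifP => _; case: ifP => _; rewrite ?mulr0 ?subr0 ?sub0r ?horner_coef.
    - rewrite !mulr_sumr -sumrB; apply: eq_bigr => h _; ring.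
    - rewrite !mulr_sumr; apply: eq_bigr => h _; ring.
    - rewrite !mulr_sumr -sumrN; apply: eq_bigr => h _; ring.
    - by rewrite big1// => h _; rewrite ?mulr0.
  rewrite (raddf_sum snd) /= big1// => h _; exact: scaler0.
have [n0 pn] := poly_natr_eventually_neq0 p0; exists n0 => c c0.
(* Solves b n p(n + 1) + p(n) b (n - 1) = c n, starting from 0 up to [n0]; beyond it p(n + 1) is
   nonzero. *)
pose fix b (n : nat) : K := if n is m.+1 then
  (if (n <= n0)%N then 0 else (c n - p.[n%:R] * b m) / p.[n.+1%:R]) else 0.
have b0 n : (n <= n0)%N -> b n = 0 by case: n => //= n ->.
pose r : hmat K := raise (fun i => b `|i|%N).
have rC : Chat_ 1 r by exact: Chat_sym.
have E : hbracket r (lower (fun i => p.[i%:~R])) = Chat0_elt c 0.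
  rewrite raise_lower; apply: Chat0_eq; try exact: Chat0_elt_in; first by [].
  move=> n n1; rewrite /= !eqxx; congr (_ * _).
  have -> : (n%:Z + 1)%:~R = n.+1%:R :> K by rewrite -addn1 natrD rmorphD.
  case: n n1 => // n _.
  have -> : (if (1 < n.+1)%N then p.[n.+1%:Z%:~R] * b `|(n.+1%:Z - 1)%R|%N else 0)
      = p.[n.+1%:R] * b n.
    case: n => [|n]; first by rewrite mulr0.
    by rewrite ltnS (_ : `|_|%N = n.+1)//; lia.
  have [nn0|nn0] := leqP n.+1 n0.
    by rewrite c0// !b0 ?mul0r ?mulr0 ?addr0// ltnW.
  by rewrite {1}/b -/b /= leqNgt nn0 /= divfK ?subrK// pn// ltnW.
have := act_bracket v rC (lowerC (fun i => p.[i%:~R])).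
rewrite E lv (vp _ _ _ rC)// (act0 (Chat_in rC)) (act0 (Chat_in (lowerC _))).
rewrite scaler0 subr0 (vh _ (Chat0_elt_in _ _)) => /eqP.
by rewrite scaler_eq0 (negbTE v0) orbF => /eqP.
Qed.

End HighestWeight.

End ModuleTheory.

(** Linearity handles only finitely many coordinates: they are split off one at a time, and the
    infinite tail is killed by the second hypothesis. *)
Lemma linear_weight_expansion (K : numFieldType) (xi : hmat K -> K) (n0 : nat) :
  linear_on_Chat0 xi ->
  (forall c : nat -> K, (forall n, (n <= n0)%N -> c n = 0) -> xi (Chat0_elt c 0) = 0) ->
  forall h, Chat_ 0 h -> xi h
    = \sum_(1 <= j < n0.+1) xi (Chat0_elt (fun n => (n == j)%:R) 0) * omega j h
      + xi (Chat0_elt (fun=> 0) 1) * Lambda0 h.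
Proof.
move=> xilin xi0 h; rewrite {1}Chat0P => -[a [d ->]].
have xiP c a1 d1 a2 d2 : xi (Chat0_elt (fun n => c * a1 n + a2 n) (c * d1 + d2))
    = c * xi (Chat0_elt a1 d1) + xi (Chat0_elt a2 d2).
  by rewrite -Chat0_eltP; apply: xilin; exact: Chat0_elt_in.
have step m : xi (Chat0_elt a d)
    = \sum_(1 <= j < m.+1) xi (Chat0_elt (fun n => (n == j)%:R) 0) * a j
      + xi (Chat0_elt (fun n => if (n <= m)%N then 0 else a n) d).
  elim: m => [|m IH].
    rewrite big_geq// add0r; congr xi; apply: Chat0_eq; try exact: Chat0_elt_in; first by [].
    by move=> n n0' /=; rewrite !eqxx leqNgt n0'.
  rewrite IH [in RHS]big_nat_recr//= -addrA; congr (_ + _).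
  rewrite [X in X + _]mulrC -xiP mulr0 add0r; congr (xi (Chat0_elt _ _)).
  apply/funext => n; case: (ltngtP n m.+1) => [nm|nm|->].
  - by rewrite -ltnS nm mulr0 addr0.
  - by rewrite leqNgt (ltnW nm) /= mulr0 add0r.
  - by rewrite ltnn mulr1 addr0.
rewrite (step n0) /Lambda0; congr (_ + _).
  by apply: eq_big_nat => j /andP[j0 _]; rewrite omegaE.
have := xiP d (fun=> 0) 1 (fun n => if (n <= n0)%N then 0 else a n) 0.
rewrite mulr1 addr0 xi0 ?addr0 => [xiE|n -> //]; rewrite /= mulrC -xiE.
by congr (xi (Chat0_elt _ _)); apply/funext => n; rewrite mulr0 add0r.
Qed.

Theorem theorem4p7 (R : realType) (M : lmodType R[i]) (Mp : bool -> set M)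
    (act : hmat R[i] -> M -> M) (xi : hmat R[i] -> R[i]) (v : M)
    (xi_linear : linear_on_Chat0 xi)
    (M_module : Chat_module Mp act)
    (M_irreducible : irreducible Mp act)
    (v_highest : highest_weight_vector act xi v) :
  [<-> quasi_finite act v;
       fin_dim [set act x v | x in Chat_ (-1)];
       exists N : nat, (0 < N)%N /\
         exists (c : nat -> R[i]) (d : R[i]), forall h : hmat R[i], Chat_ 0 h ->
           xi h = \sum_(1 <= j < (2 * N).+1) c j * omega j h + d * Lambda0 h].
Proof.
tfae.
- move=> /(_ 1%N)[s sP]; exists s => _ [x xC <-]; apply: sP; apply: lspan_incl.
  exists 1%N, (fun=> 1%N), (fun=> x); split=> //.
    by rewrite big_ord1.
  by rewrite enum_ordSl enum_ord0.
- move=> /(fin_dim_weight M_module v_highest)[n0 n0P].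
  (* Any bound with 2N >= n0 serves; the successor makes it positive. *)
  exists n0.+1; split=> //; eexists; eexists => h hC.
  apply: (linear_weight_expansion xi_linear) hC => c c0; apply: n0P => n nn0.
  by apply: c0; lia.
- move=> [N [_ [c [d xiE]]]].
  apply: (hw_component_fin_dim M_module v_highest (N := (2 * N)%N)) => //.
  move=> h hC hN h2; rewrite xiE// /Lambda0 h2 mulr0 addr0.
  rewrite big_nat_cond big1// => j /andP[/andP[_ jN] _].
  by rewrite /omega hN ?mulr0//; lia.
Qed.
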